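(* With symbolic forwarding rules, i.e. when every edge of the initial and final configurations is labelled by a formula over packet header fields, the problem of deciding whether a consistent update exists is co-NP-hard (there is a polynomial-time reduction from SAT sending a formula $\varphi$ to an instance that admits a consistent update if and only if $\varphi$ is unsatisfiable).
   Context: **Configurations.** A topology is a finite directed graph $G=(N,E)$ with designated node $H_1$. A configuration is a set $C\subseteq E$. Fix an initial configuration $C_i$ and a final configuration $C_f$. $\mathrm{out}(C,u)$ is the set of edges of $C$ with source $u$; $\mathrm{upd}(C,u)=(C\setminus \mathrm{out}(C_i,u))\cup\mathrm{out}(C_f,u)$, extended to sequences of nodes by $\mathrm{upd}(C,\varepsilon)=C$, $\mathrm{upd}(C,uS)=\mathrm{upd}(\mathrm{upd}(C,u),S)$. $\mathrm{maxpaths}(s,C)$ is the set of directed paths in $C$ starting at $s$ (possibly of length zero) that are infinite or end in a node with no outgoing edge in $C$. A configuration $C$ is consistent (with respect to $C_i,C_f$) if every path in $\mathrm{maxpaths}(H_1,C)$ belongs to $\mathrm{maxpaths}(H_1,C_i)\cup\mathrm{maxpaths}(H_1,C_f)$. **Symbolic rules.** Each edge of $C_i$ and of $C_f$ is labelled by a formula over packet header fields (for instance a propositional formula over header bits). A packet type is an assignment of values to the header fields. A packet can be forwarded along an edge only if its header fields satisfy the edge's formula; thus each packet type $a$ determines the restricted configurations $C_i^a\subseteq C_i$ and $C_f^a\subseteq C_f$ consisting of the edges whose label is satisfied by $a$. **Consistent update.** An ordering $t_1\cdots t_{|N|}$ of $N$ (each node updated exactly once, from all its initial rules to all its final rules,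 with a wait after every update) such that for every packet type $a$ and every $0\le j\le |N|$, the configuration obtained from $C_i^a$ by updating $t_1,\dots,t_j$ (with respect to $C_i^a$ and $C_f^a$) is consistent with respect to $C_i^a,C_f^a$. The decision problem: given $G$, $H_1$, and the labelled $C_i,C_f$, does a consistent update exist? *)

(* Defs.v *)
From mathcomp Require Import all_boot.

Set Implicit Arguments.
Unset Strict Implicit.
Unset Printing Implicit Defensive.

Section Configurations.
Variable N : finType.

Definition config := {set N * N}.

Implicit Types (C Ci Cf : config) (u s : N).

Definition out C u : config := [set e in C | e.1 == u].

Definition upd Ci Cf C u : config := (C :\: out Ci u) :|: out Cf u.

Definition upds Ci Cf C (S : seq N) : config := foldl (upd Ci Cf) C S.

(* [FinPath x p] visits x, then the nodes of p (length zero if p is empty);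
   nodes may be repeated. *)
Inductive dipath : Type :=
| FinPath (x : N) (p : seq N)
| InfPath (p : nat -> N).

Definition maxpaths s C (p : dipath) : Prop :=
  match p with
  | FinPath x q =>
      [/\ x = s, path [rel v w | (v, w) \in C] x q & out C (last x q) = set0]
  | InfPath q => q 0 = s /\ forall k, (q k, q k.+1) \in C
  end.

Definition consistent (H1 : N) Ci Cf C : Prop :=
  forall p, maxpaths H1 C p -> maxpaths H1 Ci p \/ maxpaths H1 Cf p.

End Configurations.

Inductive form (h : nat) : Type :=
| FTrue
| FVar of 'I_h
| FNot of form h
| FAnd of form h & form h
| FOr of form h & form h.
Arguments FTrue {h}.

Definition valuation (h : nat) := {ffun 'I_h -> bool}.

Fixpoint sat_by h (a : valuation h) (f : form h) : bool :=
  match f with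
  | FTrue => true
  | FVar i => a i
  | FNot g => ~~ sat_by a g
  | FAnd g1 g2 => sat_by a g1 && sat_by a g2
  | FOr g1 g2 => sat_by a g1 || sat_by a g2
  end.

Record formula := Formula { nvars : nat; body : form nvars }.

Definition satisfiable (phi : formula) : Prop :=
  exists a : valuation (nvars phi), sat_by a (body phi).

(* The header of a packet consists of [width] bits, so that a packet type is a
   [valuation width].  A label [Some f] at e means that e belongs to the
   configuration and carries the formula f; [None] means that it does not
   belong to the configuration. *)
Record instance := Instance {
  width : nat;
  nnodes : nat;
  host : 'I_nnodes;
  edges : {set 'I_nnodes * 'I_nnodes};
  ilabel : {ffun 'I_nnodes * 'I_nnodes -> option (form width)};
  flabel : {ffun 'I_nnodes * 'I_nnodes -> option (form width)};
  ilabelP : [forall e, isSome (ilabel e) ==> (e \in edges)];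
  flabelP : [forall e, isSome (flabel e) ==> (e \in edges)]
}.

Definition restrict h n (lab : {ffun 'I_n * 'I_n -> option (form h)})
    (a : valuation h) : config 'I_n :=
  [set e | if lab e is Some f then sat_by a f else false].

Definition consistent_update (I : instance) (t : seq 'I_(nnodes I)) : Prop :=
  perm_eq t (enum 'I_(nnodes I)) /\
  forall (a : valuation (width I)) (j : nat), j <= nnodes I ->
    let Ci := restrict (ilabel I) a in
    let Cf := restrict (flabel I) a in
    consistent (host I) Ci Cf (upds Ci Cf Ci (take j t)).

Definition has_consistent_update (I : instance) : Prop :=
  exists t : seq 'I_(nnodes I), consistent_update t.

(* Numbers are written in unary, with [false] as terminator. *)
Definition enc_nat (m : nat) : seq bool := rcons (nseq m true) false.

(* Prefix notation; each connective is announced by its number. *)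
Fixpoint enc_form h (f : form h) : seq bool :=
  match f with
  | FTrue => enc_nat 0
  | FVar i => enc_nat 1 ++ enc_nat i
  | FNot g => enc_nat 2 ++ enc_form g
  | FAnd g1 g2 => enc_nat 3 ++ enc_form g1 ++ enc_form g2
  | FOr g1 g2 => enc_nat 4 ++ enc_form g1 ++ enc_form g2
  end.

Definition enc_label h (l : option (form h)) : seq bool :=
  if l is Some f then true :: enc_form f else [:: false].

Definition enc_formula (phi : formula) : seq bool :=
  enc_nat (nvars phi) ++ enc_form (body phi).

Definition enc_edge (I : instance) (e : 'I_(nnodes I) * 'I_(nnodes I)) :
    seq bool :=
  (e \in edges I) :: enc_label (ilabel I e) ++ enc_label (flabel I e).

(* The graph and its labels are given by the adjacency matrix, row by row. *)
Definition enc_instance (I : instance) : seq bool :=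
  enc_nat (width I) ++ enc_nat (nnodes I) ++ enc_nat (host I) ++
  flatten [seq enc_edge (u, v) | u <- enum 'I_(nnodes I),
                                 v <- enum 'I_(nnodes I)].

Lemma enc_nat_inj m n s t :
  enc_nat m ++ s = enc_nat n ++ t -> m = n /\ s = t.
Proof.
by elim: m n => [|m IH] [|n] //= [] => [->|/IH [-> ->]].
Qed.

Lemma enc_form_inj h (f g : form h) s t :
  enc_form f ++ s = enc_form g ++ t -> f = g /\ s = t.
Proof.
elim: f g s t => [|i|f IH|f1 IH1 f2 IH2|f1 IH1 f2 IH2]
  [|j|g|g1 g2|g1 g2] s t //=.
- by case.
- by case=> /enc_nat_inj [/val_inj -> ->].
- by case=> /IH [-> ->].
- by rewrite -!catA; case=> /IH1 [->] /IH2 [-> ->].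
- by rewrite -!catA; case=> /IH1 [->] /IH2 [-> ->].
Qed.

Lemma enc_label_inj h (k l : option (form h)) s t :
  enc_label k ++ s = enc_label l ++ t -> k = l /\ s = t.
Proof. by case: k l => [f|] [g|] //= [] => [/enc_form_inj [-> ->]|->]. Qed.

Lemma enc_formula_inj : injective enc_formula.
Proof.
move=> [h f] [k g]; rewrite /enc_formula /= => /enc_nat_inj [hk].
subst k => fg; suff [-> _] : f = g /\ [::] = [::] :> seq bool by [].
by apply: enc_form_inj; rewrite !cats0.
Qed.

Lemma enc_instance_inj : injective enc_instance.
Proof.
move=> [h n H E li lf Pi Pf] [h' n' H' E' li' lf' Pi' Pf'].
rewrite /enc_instance /= => /enc_nat_inj [hh] /enc_nat_inj [nn].
subst h' n' => /enc_nat_inj [/val_inj HH]; subst H'.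
set I := Instance _ Pi Pf; set I' := Instance _ Pi' Pf'.
set r := [seq (u, v) | u <- enum 'I_n, v <- enum 'I_n].
have rP e : e \in r.
  case: e => u v; apply/allpairsP; exists (u, v); split=> //=;
  exact: mem_enum.
have flat (J : instance) (F : 'I_n * 'I_n -> seq bool) :
  [seq F (u, v) | u <- enum 'I_n, v <- enum 'I_n] = map F r.
  by rewrite map_allpairs.
rewrite (flat I (@enc_edge I)) (flat I (@enc_edge I')) => eqr.
have eqe e : [/\ (e \in E) = (e \in E'), li e = li' e & lf e = lf' e].
  move: (rP e) eqr; elim: r {rP flat} => //= e0 r IH.
  rewrite inE /enc_edge /= -!catA => er [].
  move=> e1 /enc_label_inj [e2] /enc_label_inj [e3] /IH {}IH.
  by case/orP: er => [/eqP ->|/IH].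
have EE : E = E' by apply/setP=> e; case: (eqe e).
have ii : li = li' by apply/ffunP=> e; case: (eqe e).
have ff : lf = lf' by apply/ffunP=> e; case: (eqe e).
rewrite /I /I'; subst E' li' lf'.
by rewrite (bool_irrelevance Pi Pi') (bool_irrelevance Pf Pf').
Qed.

Inductive move := MoveL | MoveS | MoveR.

(* A machine has at least two tapes: tape [ord0] holds the input and tape
   [ord_max] the output.  Cells contain [None] (blank), an input bit or a symbol
   of a finite auxiliary alphabet. *)
Record machine := Machine {
  extra : nat;
  state : finType;
  aux : finType;
  start : state;
  halt : pred state;
  delta : state -> {ffun 'I_extra.+2 -> option (bool + aux)} ->
          state * ('I_extra.+2 -> option (bool + aux) * move)
}.

Definition symbol (M : machine) := option (bool + aux M).

(* One-way infinite tape: moving left from cell 0 stays there. *)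
Record tape (M : machine) := Tape { cells : nat -> symbol M; pos : nat }.

Record tm_config (M : machine) := TMConfig {
  control : state M;
  tapes : 'I_(extra M).+2 -> tape M
}.

Definition move_pos (d : move) (p : nat) : nat :=
  match d with MoveL => p.-1 | MoveS => p | MoveR => p.+1 end.

Definition act (M : machine) (T : tape M) (bd : symbol M * move) : tape M :=
  Tape (fun j => if j == pos T then bd.1 else cells T j) (move_pos bd.2 (pos T)).

Definition step (M : machine) (c : tm_config M) : tm_config M :=
  if halt (control c) then c else
  let r := delta (control c) [ffun i => cells (tapes c i) (pos (tapes c i))] in
  TMConfig r.1 (fun i => act (tapes c i) (r.2 i)).

Definition word_cells (M : machine) (w : seq bool) (j : nat) : symbol M :=
  nth None [seq Some (inl b) | b <- w] j.

Definition initial (M : machine) (w : seq bool) : tm_config M :=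
  TMConfig (start M)
    (fun i => Tape (word_cells M (if i == ord0 then w else [::])) 0).

(* On input w, M halts within T steps with exactly v on its output tape. *)
Definition outputs_within (M : machine) (w v : seq bool) (T : nat) : Prop :=
  let c := iter T (@step M) (initial M w) in
  halt (control c) /\ forall j, cells (tapes c ord_max) j = word_cells M v j.

Definition poly_time (X Y : Type) (encX : X -> seq bool) (encY : Y -> seq bool)
    (f : X -> Y) : Prop :=
  exists (M : machine) (c k : nat),
    forall x, outputs_within M (encX x) (encY (f x)) (c * size (encX x) ^ k + c).

(* Main.v *)
Require Import Defs.
From mathcomp Require Import all_boot zify.

(** Write nodes 0, 1, 2 with host 0, initial rules 0 -> 1 -> 2 and final rules
    0 -> 2 -> 1.  Whichever node is updated first, the packet stops early or
    loops between 1 and 2, so no consistent update exists.  If the initial rule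
    1 -> 2 is removed, node 1 has no rules, node 2 is not reached before node 0
    is updated, and the order 1, 2, 0 is consistent.  Hence labelling 1 -> 2 by
    the formula and every other edge by "true" gives the reduction.  As the graph
    is fixed, the encoding of the instance is that of the formula with constant
    words inserted, and a machine making one pass over its input computes it. *)

Set Implicit Arguments.
Unset Strict Implicit.
Unset Printing Implicit Defensive.

(** * Configurations *)

Lemma in_upd (N : finType) (Ci Cf C : config N) u v w :
  ((v, w) \in upd Ci Cf C u) =
  if v == u then ((v, w) \in Cf) || ((v, w) \in C) && ((v, w) \notin Ci)
  else (v, w) \in C.
Proof.
by rewrite /upd /out !inE /=; case: (v == u); rewrite ?andbT ?andbF ?orbF //= orbC andbC.
Qed.

Lemma out_eq0P (N : finType) (C : config N) u :
  reflect (forall w, (u, w) \notin C) (out C u == set0).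
Proof.
apply: (iffP eqP) => [E w|E].
  by have := in_set0 (u, w); rewrite -E !inE eqxx andbT => ->.
apply/setP=> -[v w]; rewrite !inE /=; case: eqP => [->|_]; last by rewrite andbF.
by rewrite andbT; apply/negbTE.
Qed.

(** A path starting in [S] never leaves it, so its edges and its possible dead end are decided by
    the edges leaving nodes of [S]. *)
Lemma maxpaths_agree (N : finType) (S : pred N) (C C' : config N) s p :
    S s -> (forall v w, S v -> (v, w) \in C -> S w) ->
    (forall v w, S v -> ((v, w) \in C) = ((v, w) \in C')) ->
  maxpaths s C p -> maxpaths s C' p.
Proof.
move=> Ss closed agree; case: p => [x p|p] /= [].
  move=> ->; elim: p s Ss => [|y p IH] s Ss /=.
    move=> _ /eqP/out_eq0P out0; split=> //.
    by apply/eqP/out_eq0P => w; rewrite -agree.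
  case/andP=> sy py outy; rewrite -agree // sy.
  by have [_ -> ->] := IH y (closed _ _ Ss sy) py outy.
move=> p0 step; split=> // k; rewrite -agree //.
by elim: k => [|k IH]; [rewrite p0 | apply: closed (step k)].
Qed.

(** * The gadget *)

Section Gadget.
Variable phi : formula.

Definition gadget_ilabel :
    {ffun 'I_3 * 'I_3 -> option (form (nvars phi))} :=
  [ffun e => match val e.1, val e.2 with
             | 0, 1 => Some FTrue
             | 1, 2 => Some (body phi)
             | _, _ => None
             end].

Definition gadget_flabel :
    {ffun 'I_3 * 'I_3 -> option (form (nvars phi))} :=
  [ffun e => match val e.1, val e.2 with
             | 0, 2 | 2, 1 => Some FTrue
             | _, _ => None
             end].

Definition gadget_edges : {set 'I_3 * 'I_3} :=
  [set e | gadget_ilabel e || gadget_flabel e].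

Lemma gadget_ilabelP :
  [forall e, isSome (gadget_ilabel e) ==> (e \in gadget_edges)].
Proof. by apply/forallP=> e; rewrite inE; case: (gadget_ilabel e). Qed.

Lemma gadget_flabelP :
  [forall e, isSome (gadget_flabel e) ==> (e \in gadget_edges)].
Proof. by apply/forallP=> e; rewrite inE orbC; case: (gadget_flabel e). Qed.

Definition gadget : instance :=
  @Instance (nvars phi) 3 ord0 gadget_edges _ _ gadget_ilabelP gadget_flabelP.

Definition node1 : 'I_3 := Ordinal (isT : 1 < 3).
Definition node2 : 'I_3 := Ordinal (isT : 2 < 3).

Lemma node_ind (P : 'I_3 -> Prop) : P ord0 -> P node1 -> P node2 -> forall v, P v.
Proof.
by move=> P0 P1 P2 [[|[|[|v]]] lt_v] //;
  [move: P0 | move: P1 | move: P2]; congr P; apply: val_inj.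
Qed.

Variable a : valuation (nvars phi).
Let Ci := restrict gadget_ilabel a.
Let Cf := restrict gadget_flabel a.

Lemma in_gadget_initial v w : ((v, w) \in Ci) =
  match val v, val w with 0, 1 => true | 1, 2 => sat_by a (body phi) | _, _ => false end.
Proof. by rewrite inE ffunE; elim/node_ind: v; elim/node_ind: w. Qed.

Lemma in_gadget_final v w : ((v, w) \in Cf) =
  match val v, val w with 0, 2 | 2, 1 => true | _, _ => false end.
Proof. by rewrite inE ffunE; elim/node_ind: v; elim/node_ind: w. Qed.

Lemma gadget_consistent j : ~~ sat_by a (body phi) ->
  consistent ord0 Ci Cf (upds Ci Cf Ci (take j [:: node1; node2; ord0])).
Proof.
move=> unsat p; case: (ltnP j 3) => [lt_j3|le_3j] Cp; [left | right].
  (* While node 0 is not updated, packets stay in nodes 0 and 1; node 1 has no rule before or after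
     its own update, so the initial behaviour persists. *)
  move: Cp; apply: (@maxpaths_agree _ [pred v : 'I_3 | val v < 2]) => //= v w;
    by case: j lt_j3 => [|[|[|]]] // _;
    elim/node_ind: v => //; elim/node_ind: w => // _;
    rewrite /= ?in_upd /= ?in_gadget_initial ?in_gadget_final /= ?(negbTE unsat).
(* Once every node is updated, the configuration is [Cf] itself. *)
move: Cp; apply: (@maxpaths_agree _ predT) => // v w _.
rewrite take_oversize //=.
by elim/node_ind: v; elim/node_ind: w;
  rewrite !in_upd /= !in_gadget_initial !in_gadget_final //= ?(negbTE unsat).
Qed.

Lemma gadget_inconsistent u : sat_by a (body phi) ->
  ~ consistent ord0 Ci Cf (upd Ci Cf Ci u).
Proof.
move=> sat; elim/node_ind: u.
- move/(_ (FinPath ord0 [:: node2])) => []; first split=> //.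
  + by rewrite /= in_upd /= in_gadget_final.
  + apply/eqP/out_eq0P; elim/node_ind;
      by rewrite in_upd /= !in_gadget_initial.
  + by case=> _ /=; rewrite in_gadget_initial.
  + by case=> _ _ /eqP/out_eq0P/(_ node1); rewrite in_gadget_final.
(* Node 1 first: its rule to 2 is gone and no final rule replaces it, so the packet stops at 1. *)
- move/(_ (FinPath ord0 [:: node1])) => []; first split=> //.
  + by rewrite /= in_upd /= in_gadget_initial.
  + apply/eqP/out_eq0P; elim/node_ind;
      by rewrite in_upd /= !in_gadget_initial !in_gadget_final //= sat.
  + by case=> _ _ /eqP/out_eq0P/(_ node2); rewrite in_gadget_initial /= sat.
  + by case=> _ /=; rewrite in_gadget_final.
(* Node 2 first: the walk is 0, 1, 2, 1, 2, and so on. Its edge 2 -> 1 is not initial and 0 -> 1 is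
   not final. *)
- pose q k := if k is k'.+1 then if odd k' then node2 else node1 else ord0.
  move/(_ (InfPath q)) => []; first split=> // -[|k] /=.
  + by rewrite in_upd /= in_gadget_initial.
  + by case: (odd k); rewrite in_upd /= ?in_gadget_final // in_gadget_initial /= sat.
  + by case=> _ /(_ 2); rewrite in_gadget_initial.
  + by case=> _ /(_ 0); rewrite in_gadget_final.
Qed.

End Gadget.

Lemma gadget_correct phi :
  has_consistent_update (gadget phi) <-> ~ satisfiable phi.
Proof.
split=> [[t [perm_t cons_t]] [a sat_a]|unsat].
  have: size t = 3 by rewrite (perm_size perm_t) size_enum_ord.
  case: t cons_t {perm_t} => // u t /(_ a 1 isT) /=; rewrite take0 => cons_u _.
  exact: gadget_inconsistent cons_u.
exists [:: node1; node2; ord0]; split=> [|a j _].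
  apply: uniq_perm => //; first exact: enum_uniq.
  by elim/node_ind; rewrite mem_enum.
by apply: gadget_consistent; apply/negP=> sat_a; apply: unsat; exists a.
Qed.

(* The words surrounding the two halves of [enc_formula phi] in the encoding of
   the gadget. *)
Definition gadget_prefix : seq bool :=
  [:: true; true; true; false;  false;
      false; false; false;  true; true; false; false;  true; false; true; false;
      false; false; false;  false; false; false;  true; true].

Definition gadget_suffix : seq bool :=
  [:: false;  false; false; false;  true; false; true; false;
      false; false; false].

(** The width [nvars phi] comes first; the body is the initial label of 1 -> 2, the sixth matrix
    entry. *)
Lemma enc_gadget phi : enc_instance (gadget phi) =
  enc_nat (nvars phi) ++ gadget_prefix ++ enc_form (body phi) ++ gadget_suffix.
Proof.
have enum3 : enum 'I_3 = [:: ord0; node1; node2].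
  by apply: (inj_map val_inj); rewrite val_enum_ord.
rewrite /enc_instance /= enum3 /= /enc_edge /=.
by rewrite !inE !ffunE /= -!catA.
Qed.

(** * One-pass programs *)

(** [CopyNat] ends after copying a terminator [false], [CopyRest] only on reading a blank. *)
Inductive instr := CopyNat | CopyRest | Write of bool.

(* Whether to go to the next instruction, whether to advance on the input, and
   the bit to be written, if any. *)
Definition instr_step (i : instr) (r : option bool) : bool * bool * option bool :=
  match i, r with
  | Write b, _ => (true, false, Some b)
  | CopyNat, Some b => (~~ b, true, Some b)
  | CopyRest, Some b => (false, true, Some b)
  | _, None => (true, false, None)
  end.

Section Program.
Variable prog : seq instr.

(* Program counter, unread input, output. *)
Definition prog_step (x : nat * seq bool * seq bool) :=
  let: (q, s, v) := x in
  if size prog <= q then x else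
  let: (next, adv, o) := instr_step (nth CopyNat prog q) (ohead s) in
  (next + q, drop adv s, v ++ seq_of_opt o).

Definition prog_delta (q : 'I_(size prog).+1)
    (r : {ffun 'I_2 -> option (bool + void)}) :=
  let b := if r ord0 is Some (inl b) then Some b else None in
  let: (next, adv, o) := instr_step (nth CopyNat prog q) b in
  (inord (next + q) : 'I_(size prog).+1,
   fun i => if i == ord0 then (r i, if adv then MoveR else MoveS)
            else if o is Some b then (Some (inl b), MoveR) else (r i, MoveS)).

Definition prog_machine : machine :=
  @Machine 0 'I_(size prog).+1 void ord0 [pred q | size prog <= val q] prog_delta.

(** Simulation invariant: the input tape keeps [w], so the unread input is fixed by the head
    position; the output head stands just past the written word. *)
Definition represents (w : seq bool) (c : tm_config prog_machine)
    (x : nat * seq bool * seq bool) : Prop :=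
  let: (q, s, v) := x in
  [/\ val (control c) = q,
      forall j, cells (tapes c ord0) j = word_cells prog_machine w j,
      s = drop (pos (tapes c ord0)) w,
      forall j, cells (tapes c ord_max) j = word_cells prog_machine v j &
      pos (tapes c ord_max) = size v].

Lemma word_cells_ohead w p : word_cells prog_machine w p =
  omap inl (ohead (drop p w)).
Proof.
by rewrite /word_cells; elim: w p => [|b w IH] [|p] //=.
Qed.

Lemma word_cells_rcons v b j : word_cells prog_machine (v ++ [:: b]) j =
  if j == size v then Some (inl b) else word_cells prog_machine v j.
Proof.
rewrite /word_cells map_cat /= nth_cat size_map.
case: ltngtP => [//|lt_vj|->]; last by rewrite subnn.
by rewrite !nth_default ?size_map ?subn_gt0 // ltnW.
Qed.

Lemma represents_step w c x :
  represents w c x -> represents w (@step prog_machine c) (prog_step x).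
Proof.
case: x => [[q s] v] [cq in_c cs out_c pos_c].
rewrite /step /prog_step /= cq.
case: leqP => [//|lt_q].
rewrite /prog_delta ffunE in_c word_cells_ohead -cs cq.
have -> : match omap inl (ohead s) with
          | Some (inl b) => Some b | _ => None end = ohead s :> option bool.
  by case: s {cs} => [|b s].
case: (instr_step _ _) => [[next adv] o] /=.
rewrite /represents /= !ffunE; split.
(* The counter is below [size prog] here, so [inord] does not overflow. *)
- by rewrite inordK // ltnS; case: next => //; rewrite ltnW.
- by move=> j /=; case: eqP => [->|_]; rewrite in_c.
- by rewrite cs; case: adv; rewrite /= ?drop_drop ?add1n ?drop0.
- case: o => [b|] j /=; first by rewrite word_cells_rcons pos_c out_c.
  by rewrite cats0; case: eqP => [->|_]; rewrite out_c.
- by rewrite size_cat; case: o => [b|] /=; rewrite pos_c ?addn1 ?addn0.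
Qed.

Lemma represents_initial w :
  represents w (initial prog_machine w) (0, w, [::]).
Proof. by split=> //=; rewrite drop0. Qed.

(** A finished program idles, so the steps from [n] up to [m] change nothing. *)
Lemma prog_outputs w v n s m :
    iter n prog_step (0, w, [::]) = (size prog, s, v) -> n <= m ->
  outputs_within prog_machine w v m.
Proof.
move=> run le_nm.
have: represents w (iter m (@step prog_machine) (initial prog_machine w))
                   (size prog, s, v).
  rewrite -(subnK le_nm); have -> : (size prog, s, v) =
      iter (m - n + n) prog_step (0, w, [::]).
    by rewrite iterD run; elim: (m - n) => //= k <-; rewrite /= leqnn.
  elim: (m - n + n) => [|k IH]; first exact: represents_initial.
  by rewrite !iterS; apply: represents_step.
by case=> /= cq _ _ out_v _; split=> //=; rewrite /= cq.
Qed.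

Lemma run_copy_nat q h s v : q < size prog -> nth CopyNat prog q = CopyNat ->
  iter h.+1 prog_step (q, enc_nat h ++ s, v) = (q.+1, s, v ++ enc_nat h).
Proof.
move=> lt_q pq; elim: h v => [|h IH] v.
  by rewrite /= leqNgt lt_q pq /= drop0.
rewrite iterSr {2}/prog_step leqNgt lt_q pq [enc_nat h.+1 ++ s]/= /=.
by rewrite drop0 -/(enc_nat h) -iterS IH -catA.
Qed.

(** The extra step is the one that reads the blank. *)
Lemma run_copy_rest q s v : q < size prog -> nth CopyNat prog q = CopyRest ->
  iter (size s).+1 prog_step (q, s, v) = (q.+1, [::], v ++ s).
Proof.
move=> lt_q pq; elim: s v => [|b s IH] v; first by rewrite /= leqNgt lt_q pq.
rewrite iterSr {2}/prog_step leqNgt lt_q pq /=.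
by rewrite drop0 -iterS IH -catA.
Qed.

Lemma run_write q u s v :
    (forall i, i < size u -> q + i < size prog /\
       nth CopyNat prog (q + i) = Write (nth false u i)) ->
  iter (size u) prog_step (q, s, v) = (size u + q, s, v ++ u).
Proof.
elim: u q v => [|b u IH] q v write_u; first by rewrite cats0.
have [lt_q pq] := write_u 0 isT; rewrite addn0 in lt_q pq.
rewrite [size _]/= iterSr {2}/prog_step leqNgt lt_q pq /= drop0 IH.
  by rewrite -catA add1n addnS.
by move=> i lt_i; rewrite add1n addSnnS; apply: write_u.
Qed.

End Program.

Definition gadget_prog : seq instr :=
  CopyNat :: map Write gadget_prefix ++ CopyRest :: map Write gadget_suffix.

Lemma run_gadget_prog phi :
  iter (size gadget_suffix + (size (enc_form (body phi))).+1 +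
        size gadget_prefix + (nvars phi).+1)
       (prog_step gadget_prog) (0, enc_formula phi, [::]) =
  (size gadget_prog, [::], enc_instance (gadget phi)).
Proof.
rewrite enc_gadget iterD run_copy_nat // iterD run_write; last first.
  (* The constant words have 24 and 11 bits, so 30 case splits exhaust the indices. *)
  by move=> i; do 30 case: i => [|i] //.
rewrite iterD run_copy_rest // run_write; last first.
  by move=> i; do 30 case: i => [|i] //.
by rewrite -!catA.
Qed.

Theorem mainTheorem2 :
  exists f : formula -> instance,
    poly_time enc_formula enc_instance f /\
    forall phi : formula, has_consistent_update (f phi) <-> ~ satisfiable phi.
Proof.
exists gadget; split; last exact: gadget_correct.
(* The run takes 36 steps more than the input has bits: 35 writes and one reading of the blank. *)
exists (prog_machine gadget_prog), 40, 1 => phi.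
apply: prog_outputs (run_gadget_prog phi) _.
rewrite expn1 /enc_formula size_cat /enc_nat size_rcons size_nseq.
rewrite /=; lia.
Qed.
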